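(* Solving simplex enumeration and (respectively) triangle enumeration with sufficiently large probability in the EC, EB, EU, ES, and EP models in hypergraphs with $n$ vertices requires $\Omega(n^{1/(r+1)}/\log n)$ and $\Omega(n^{1/3}/\log n)$ rounds, respectively, where $r$ is a constant and the hypergraphs considered are $r$-uniform.
   Context: A hypergraph $H=(V,E)$ has vertex set $V$, $|V|=n$, and a set $E$ of nonempty subsets of $V$; it is $r$-uniform if every edge has exactly $r$ vertices. An $r$-dimensional simplex is a set of $r+1$ vertices all of whose $r$-element subsets are edges. A triangle is a simple cycle of length three $(v_0,e_0,v_1,e_1,v_2,e_2)$: distinct vertices, distinct edges, $v_i\in e_{i-1}\cap e_i$ (indices mod $3$); it is induced if moreover $v_i\notin e_{i+1}$ for each $i$. In the simplex (triangle) enumeration problem each vertex outputs a set of simplices (triangles) such that these sets are pairwise disjoint and their union is the set of all simplices (triangles) of $H$; the triangle result applies both to all triangles and to all induced triangles. Computation: vertices are nodes with unique $O(\log n)$-bit IDs; synchronous rounds with unbounded local computation; algorithms may be randomized; messages have $B=\Theta(\log n)$ bits; initially each vertex knows its ID and its incident edges, including the IDs of the vertices in them ($\mathrm{KT}_1$). In one round: EC (EDGE CLIQUE): for each $v$ and each edge $e\ni v$, $v$ can send distinct $B$-bit messages to each other vertex of $e$. EB (EDGE BROADCAST): for each $v$ and $e\ni v$, $v$ can broadcast one $B$-bit message to all of $e$. EU (EDGE UNICAST): for each $v$ and $e\ni v$, $v$ sends one $B$-bit message to one chosen vertex of $e$. ES (EDGE SOLOCAST): each edge $e$ specifies one vertex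 $v\in e$ that broadcasts one $B$-bit message to all of $e$. EP (EDGE PAIRCAST): each edge $e$ specifies one pair $u,v\in e$ that can exchange $B$-bit messages. *)

(* Defs.v *)
From HB Require Import structures.
From mathcomp Require Import all_boot all_order all_algebra.
From mathcomp Require Import all_classical all_reals all_analysis.

Set Implicit Arguments.
Unset Strict Implicit.
Unset Printing Implicit Defensive.

Import Order.TTheory GRing.Theory Num.Theory.
Import numFieldNormedType.Exports.
Local Open Scope ring_scope.

(* Vertices are identified with their IDs: [U] is the space of all possible
   IDs, and the vertex set of a hypergraph is a set of IDs. Quantifying over
   all [hypergraph U] with n vertices therefore covers every n-vertex
   hypergraph under every assignment of unique IDs. *)
Record hypergraph (U : finType) := Hypergraph {
  vertices : {set U};
  edges : {set {set U}};
  edges_valid : forall e, e \in edges -> e != finset.set0 /\ e \subset vertices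
}.

Definition uniform (r : nat) (U : finType) (H : hypergraph U) : Prop :=
  forall e, e \in edges H -> #|e| = r.

Definition incident (U : finType) (H : hypergraph U) (v : U) : {set {set U}} :=
  [set e in edges H | v \in e]%SET.

Definition simplices (r : nat) (U : finType) (H : hypergraph U) : {set {set U}} :=
  [set s : {set U} | [&& s \subset vertices H, #|s| == r.+1 &
     [forall f : {set U}, (f \subset s) && (#|f| == r) ==> (f \in edges H)]]]%SET.

(* (v_0, e_0, v_1, e_1, v_2, e_2) is stored as the pair (i |-> v_i, i |-> e_i);
   arithmetic in 'I_3 is modulo 3. *)
Definition cycle3 (U : finType) : finType :=
  ({ffun 'I_3 -> U} * {ffun 'I_3 -> {set U}})%type.

Definition is_triangle (U : finType) (H : hypergraph U) (t : cycle3 U) : bool :=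
  [&& injectiveb t.1, injectiveb t.2, [forall i : 'I_3, t.2 i \in edges H] &
      [forall i : 'I_3, (t.1 i \in t.2 (i - 1)) && (t.1 i \in t.2 i)]].

Definition is_induced (U : finType) (t : cycle3 U) : bool :=
  [forall i : 'I_3, t.1 i \notin t.2 (i + 1)].

Definition triangles (U : finType) (H : hypergraph U) : {set cycle3 U} :=
  [set t | is_triangle H t]%SET.

Definition induced_triangles (U : finType) (H : hypergraph U) : {set cycle3 U} :=
  [set t | is_triangle H t && is_induced t]%SET.

Inductive model := EC | EB | EU | ES | EP.

Definition message (B : nat) := (B.-tuple bool : finType).

(* What a vertex receives in one round: at [(e, u)], the message (if any)
   that came from vertex [u] through edge [e]. *)
Definition inbox (U : finType) (B : nat) :=
  {ffun {set U} * U -> option (message B)}.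

(* Everything a vertex knows at the beginning of a round: its ID, its incident
   edges as sets of IDs (KT_1), its private infinite tape of random bits, and
   the messages received in the earlier rounds, oldest first. Since local
   computation is unbounded, this is the local state without loss of
   generality. The round number is [size (view_received _)]. *)
Record view (U : finType) (B : nat) := View {
  view_id : U;
  view_edges : {set {set U}};
  view_coins : nat -> bool;
  view_received : seq (inbox U B)
}.

(* The communication part of an algorithm. Sending [None] is staying silent.
   In ES and EP, an edge selects its speaker (resp. its pair) by a rule that may
   inspect the current states of the vertices of that edge, and only those: its
   argument maps the members of the edge to their views and all other IDs to
   [None]. A rule designating somebody outside the edge lets nobody speak. *)
Definition protocol (M : model) (U : finType) (B : nat) : Type :=
  match M with
  | EC => view U B -> {set U} -> U -> option (message B)
  | EB => view U B -> {set U} -> option (message B)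
  | EU => view U B -> {set U} -> option (U * message B)
  | ES => (({set U} -> (U -> option (view U B)) -> U) *
           (view U B -> {set U} -> option (message B)))%type
  | EP => (({set U} -> (U -> option (view U B)) -> U * U) *
           (view U B -> {set U} -> U -> option (message B)))%type
  end.

Definition views_on (U : finType) (B : nat) (e : {set U}) (s : U -> view U B) :
    U -> option (view U B) :=
  fun x => if x \in e then Some (s x) else None.

(* [transmit p s e u w] is the message that passes from [u] to [w] through the
   edge [e] in a round in which the states of the vertices are [s]. *)
Definition transmit (M : model) (U : finType) (B : nat) :
    protocol M U B -> (U -> view U B) -> {set U} -> U -> U -> option (message B) :=
  match M return protocol M U B -> (U -> view U B) -> {set U} -> U -> U ->
                 option (message B) with
  | EC => fun p s e u w => if u != w then p (s u) e w else None
  | EB => fun p s e u w => p (s u) e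
  | EU => fun p s e u w =>
      if p (s u) e is Some (x, m) then (if x == w then Some m else None) else None
  | ES => fun p s e u w =>
      if p.1 e (views_on e s) == u then p.2 (s u) e else None
  | EP => fun p s e u w =>
      let ab := p.1 e (views_on e s) in
      if (u != w) && ((ab == (u, w)) || (ab == (w, u)))
      then p.2 (s u) e w else None
  end.

Definition receive (M : model) (U : finType) (B : nat) (H : hypergraph U)
    (p : protocol M U B) (s : U -> view U B) (w : U) : inbox U B :=
  [ffun eu : {set U} * U =>
     if [&& eu.1 \in edges H, eu.2 \in eu.1 & w \in eu.1]
     then transmit p s eu.1 eu.2 w else None].

Fixpoint run (M : model) (U : finType) (B : nat) (H : hypergraph U)
    (p : protocol M U B) (coins : U -> nat -> bool) (t : nat) : U -> view U B :=
  match t with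
  | 0%N => fun v => View v (incident H v) (coins v) [::]
  | t'.+1 => fun v =>
      let s := run H p coins t' in
      View v (incident H v) (coins v)
           (rcons (view_received (s v)) (receive H p s v))
  end.

Record algorithm (M : model) (U : finType) (B : nat) (T : finType) := Algorithm {
  rounds : nat;
  comm : protocol M U B;
  output : view U B -> {set T}
}.

Definition enumerates (U T : finType) (H : hypergraph U) (out : U -> {set T})
    (target : {set T}) : Prop :=
  (forall u v, u \in vertices H -> v \in vertices H -> u != v ->
     [disjoint out u & out v]) /\
  (\bigcup_(v in vertices H) out v)%SET = target.

Definition correct (M : model) (U : finType) (B : nat) (T : finType)
    (A : algorithm M U B T) (target : hypergraph U -> {set T})
    (H : hypergraph U) (coins : U -> nat -> bool) : Prop :=
  enumerates H (fun v => output A (run H (comm A) coins (rounds A) v)) (target H).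

Definition fair_coins (R : realType) (d : measure_display)
    (Omega : measurableType d) (P : probability Omega R) (I : eqType)
    (bit : I -> Omega -> bool) : Prop :=
  (forall i, measurable [set w | bit i w]%classic) /\
  (forall (s : seq I) (b : I -> bool), uniq s ->
     P [set w | forall i, i \in s -> bit i w = b i]%classic
     = (2^-1 ^+ size s)%:E).

(* The success probability is bounded for every n-vertex r-uniform hypergraph
   separately (worst-case input). *)
Definition solves (R : realType) (prob : R) (r n : nat) (M : model) (U : finType)
    (B : nat) (T : finType) (A : algorithm M U B T)
    (target : hypergraph U -> {set T}) (d : measure_display)
    (Omega : measurableType d) (P : probability Omega R)
    (bit : U * nat -> Omega -> bool) : Prop :=
  forall H : hypergraph U, uniform r H -> #|vertices H| = n ->
  let success := [set w | correct A target H (fun v k => bit (v, k) w)]%classic in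
  measurable success /\ (prob%:E <= P success)%E.

Local Open Scope classical_set_scope.

(* IDs are strings of [L n] bits with L = O(log n), long enough for n distinct
   IDs to exist, and messages have B = Theta(log n) bits. The random tapes of
   the vertices are independent fair bits [bit (v, 0), bit (v, 1), ...] on an
   arbitrary probability space. The algorithm may depend on n; the implied
   constant of the Omega does not depend on the algorithm. *)
Definition requires_rounds (R : realType) (r : nat) (T : finType -> finType)
    (target : forall U : finType, hypergraph U -> {set T U}) (f : nat -> R) : Prop :=
  exists2 prob : R, 0 < prob < 1 &
  forall L B : nat -> nat,
  (fun n => (L n)%:R : R) =O_\oo (fun n => ln n%:R : R) ->
  (\forall n \near \oo, (n <= 2 ^ L n)%N) ->
  (fun n => (B n)%:R : R) \is 'Theta_\oo (fun n => ln n%:R : R) ->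
  exists2 c : R, 0 < c &
  \forall n \near \oo,
  let U : finType := (L n).-tuple bool in
  forall (M : model) (A : algorithm M U (B n) (T U))
    (d : measure_display) (Omega : measurableType d) (P : probability Omega R)
    (bit : U * nat -> Omega -> bool),
  fair_coins P bit -> solves prob r n A (target U) P bit ->
  c * f n <= (rounds A)%:R.

(* Main.v *)
From mathcomp Require Import all_boot all_order all_algebra.
From mathcomp Require Import all_classical all_reals all_analysis.
From mathcomp Require Import measurable_realfun zify lra ring.
(* Imported again so that the finite-set names shadow those of classical_sets. *)
From mathcomp Require Import fintype bigop finset.
Require Import Defs.

(* The input is a uniformly random r-uniform hypergraph on a fixed set of n
   vertices: each potential edge is present with probability 1/2. Call the
   potential simplices (or triangles) patterns, and the edges of a pattern its
   support. After averaging over the coins, one may fix them so that a large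
   constant fraction of the inputs is handled correctly.

   After t rounds the view of a vertex takes at most 2 ^ N values, with
   N = O(n ^ (r - 1) * t * B). The supports of the patterns that a vertex outputs
   consist of edges of the input, so a view whose output involves more than m
   edges is compatible with at most a fraction 2 ^ - m of the inputs. Hence, for
   m slightly larger than N, the output of every vertex involves at most m edges,
   except on a small fraction of the inputs.

   The edges of such an output support few patterns: O(m ^ ((r + 1) / r))
   simplices, or O((m * n ^ (r - 2)) ^ (3 / 2)) triangles. To stay within the
   natural numbers these bounds are stated with an upper bound k on the root of
   m, resp. of m * n ^ (r - 2). On the other hand, a pattern is present in the
   input with constant probability, and there are about n ^ (r + 1) potential
   simplices, resp. n ^ (3 * (r - 1)) potential induced triangles, to be
   distributed among n vertices. Comparing the two forces t * B to be at least
   of order n ^ (1 / (r + 1)), resp. n ^ (1 / 3). *)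

Set Implicit Arguments.
Unset Strict Implicit.
Unset Printing Implicit Defensive.

Import Order.TTheory GRing.Theory Num.Theory.

Section Combinatorics.
Local Open Scope set_scope.
Local Open Scope nat_scope.

(** * Patterns supported by few edges *)

Lemma card_fiber_le (A B : finType) (f : A -> B) (X : {set A}) (Y : {set B}) c :
  (forall x, x \in X -> f x \in Y) ->
  (forall y, y \in Y -> #|[set x in X | f x == y]| <= c) -> #|X| <= #|Y| * c.
Proof.
move=> XY le_c; rewrite -sum1_card (partition_big f (mem Y)) //=.
rewrite -sum_nat_const; apply: leq_sum => y Yy.
by apply: leq_trans (le_c y Yy); rewrite -sum1dep_card leq_eqVlt eqxx.
Qed.

Lemma card_supersets (E : finType) (S : {set E}) :
  #|[set F : {set E} | S \subset F]| = 2 ^ (#|E| - #|S|).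
Proof.
have -> : [set F : {set E} | S \subset F] = [set ~: F | F in powerset (~: S)].
  apply/setP=> F; rewrite inE; apply/idP/imsetP => [SF | [G]].
    by exists (~: F); rewrite ?setCK // powersetE setCS.
  by rewrite powersetE => GS ->; rewrite -(setCK S) setCS.
by rewrite (card_imset _ (can_inj (@setCK E))) card_powerset cardsCs setCK.
Qed.

Lemma bin_leq_exp n k : 'C(n, k) <= n ^ k.
Proof.
elim: k n => [|k IH] [|n] //.
rewrite -(@leq_pmul2l k.+1) // -mul_bin_diag expnS mulnCA leq_pmul2l //.
apply: leq_trans (IH n) _; apply: leq_trans (leq_pmull _ (ltn0Sn k)).
by case: (k) => [|j]; rewrite ?expn0 // leq_exp2r.
Qed.

(** Deleting [A] is injective on the sets that contain it. With [A] of one or two elements this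
    bounds degrees and codegrees. *)
Lemma card_uniform_supersets (U : finType) (V A : {set U}) r :
  #|[set e : {set U} | [&& e \subset V, #|e| == r & A \subset e]]|
  <= #|V| ^ (r - #|A|).
Proof.
apply: leq_trans (bin_leq_exp _ _); rewrite -(cards_draws V).
rewrite -[leqLHS](card_in_imset (f := fun e => e :\: A)); last first.
  move=> e1 e2; rewrite !inE => /and3P[_ _ A1] /and3P[_ _ A2] eqD.
  by rewrite -(setID e1 A) -(setID e2 A) eqD; do 2!rewrite (setIidPr _) //.
apply/subset_leq_card/subsetP => _ /imsetP[e + ->].
rewrite !inE => /and3P[eV /eqP <- Ae].
by rewrite (subset_trans (subsetDl _ _) eV) cardsD (setIidPr Ae) eqxx.
Qed.

Definition full_simplices (U : finType) r (S : {set {set U}}) : {set {set U}} :=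
  [set s : {set U} | (#|s| == r.+1) &&
     [forall f : {set U}, (f \subset s) && (#|f| == r) ==> (f \in S)]].

Lemma double_count (A B : finType) (X : {set A}) (Y : {set B}) (R : A -> B -> bool) :
  \sum_(x in X) #|[set y in Y | R x y]| = \sum_(y in Y) #|[set x in X | R x y]|.
Proof.
under eq_bigr do rewrite -sum1dep_card.
under [RHS]eq_bigr do rewrite -sum1dep_card.
rewrite (exchange_big_dep (mem Y)) //= => [|x y _ /andP[]//].
by apply: eq_bigr => y Yy; apply: eq_bigl => x; rewrite Yy.
Qed.

Lemma sum_degree (U : finType) r (S : {set {set U}}) :
  (forall e, e \in S -> #|e| = r) ->
  \sum_(v : U) #|[set e in S | v \in e]| = #|S| * r.
Proof.
move=> unif; rewrite -sum_nat_const.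
have := double_count setT S (fun (v : U) (e : {set U}) => v \in e).
under eq_bigl do rewrite inE; move=> ->; apply: eq_bigr => e Se.
by rewrite -(unif e Se); apply: eq_card => v; rewrite !inE.
Qed.

(* Weak Kruskal-Katona bound.  With d the degree of v, at most
   min(|S|, k * d) simplices contain v: if d >= k ^ r then |S| <= k ^ r.+1 <= k * d
   bounds their number (a simplex is determined by its facet missing v), and
   otherwise the induction hypothesis applies to the link of v. *)
Lemma card_full_simplices (U : finType) r k (S : {set {set U}}) :
  0 < r -> (forall e, e \in S -> #|e| = r) -> #|S| <= k ^ r ->
  #|full_simplices r S| <= k * #|S|.
Proof.
elim: r S => [//|r IH] S _ unif leS.
(* Summed over [v], the local bound counts each simplex [r.+2] times but each edge only [r.+1]
   times. *)
suff le_v v : #|[set s in full_simplices r.+1 S | v \in s]|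
              <= k * #|[set e in S | v \in e]|.
  have unif' s : s \in full_simplices r.+1 S -> #|s| = r.+2.
    by rewrite inE => /andP[/eqP].
  have sum_le : #|full_simplices r.+1 S| * r.+2 <= k * #|S| * r.+2.
    rewrite -(sum_degree unif'); apply: (@leq_trans (k * #|S| * r.+1)).
      by rewrite -mulnA -(sum_degree unif) big_distrr /=; apply: leq_sum.
    by rewrite leq_mul2l leqnSn orbT.
  by rewrite leq_pmul2r in sum_le.
set D := [set e in S | v \in e].
set N := [set s in _ | _].
have facet s (f : {set U}) : s \in N -> f \subset s -> #|f| = r.+1 -> f \in S.
  rewrite !inE => /andP[/andP[_ /forallP/(_ f)/implyP fS] _] fs cf.
  by apply: fS; rewrite fs cf eqxx.
have Ncard s : s \in N -> #|s :\ v| = r.+1.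
  by rewrite !inE => /andP[/andP[/eqP cs _] vs]; move: (cardsD1 v s); rewrite vs; lia.
have Nv s : s \in N -> v \in s by rewrite !inE => /andP[].
have D1inj (X : {set {set U}}) : (forall s, s \in X -> v \in s) ->
    {in X &, injective (fun s : {set U} => s :\ v)}.
  by move=> Xv s1 s2 /Xv v1 /Xv v2 eqs; rewrite -(setD1K v1) -(setD1K v2) eqs.
have NleS : #|N| <= #|S|.
  rewrite -(card_in_imset (D1inj N Nv)); apply/subset_leq_card/subsetP.
  move=> _ /imsetP[s Ns ->]; apply: (facet s) (Ncard s Ns) => //.
  exact: subsetDl.
have [leD | ltD] := leqP (k ^ r) #|D|.
  apply: leq_trans NleS (leq_trans leS _).
  by rewrite expnS leq_mul2l leD orbT.
have Dv e : e \in D -> v \in e by rewrite inE => /andP[].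
set L := [set e :\ v | e in D].
have cardL : #|L| = #|D| by rewrite card_in_imset //; apply: D1inj.
have NL : #|N| <= #|full_simplices r L|.
  rewrite -(card_in_imset (D1inj N Nv)); apply/subset_leq_card/subsetP.
  move=> _ /imsetP[s Ns ->]; rewrite inE Ncard // eqxx /=.
  apply/forallP => f; apply/implyP => /andP[fs /eqP cf].
  move: fs; rewrite subsetD1 => /andP[fs vf].
  apply/imsetP; exists (v |: f); last by rewrite setU1K.
  rewrite inE setU11 andbT (facet s) //.
    by rewrite subUset sub1set Nv.
  by rewrite cardsU1 vf cf.
(* For [r = 0] the members of [S] are singletons: a simplex through [v] would have the facet
   [v |: set0] in [D], but [D] is empty. *)
have [r0|r_gt0] := posnP r.
  have D0 : #|D| = 0 by move: ltD; rewrite r0 expn0; case: #|D|.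
  have [->|[s Ns]] := set_0Vmem N; first by rewrite cards0.
  suff : v |: set0 \in D by move/eqP: D0; rewrite cards_eq0 => /eqP->; rewrite inE.
  rewrite inE setU11 andbT (facet s) // ?setU0 ?sub1set ?Nv //.
  by rewrite cards1 r0.
apply: leq_trans NL _; rewrite -cardL; apply: IH => //.
  move=> _ /imsetP[e /[dup] /Dv ve + ->]; rewrite inE => /andP[/unif ce _].
  by move: (cardsD1 v e); rewrite ve; lia.
by rewrite cardL ltnW.
Qed.

Definition triangles_on (U : finType) (S : {set {set U}}) : {set cycle3 U} :=
  [set t : cycle3 U | [&& injectiveb t.1, injectiveb t.2,
     [forall i, t.2 i \in S] &
     [forall i : 'I_3, (t.1 i \in t.2 (i - 1)%R) && (t.1 i \in t.2 i)]]].

Definition uniform_sets (U : finType) r (V : {set U}) : {set {set U}} :=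
  [set e : {set U} | (e \subset V) && (#|e| == r)].

Lemma ffun3_eq (T : Type) (f g : {ffun 'I_3 -> T}) :
  f 0%R = g 0%R -> f 1%R = g 1%R -> f (-1)%R = g (-1)%R -> f = g.
Proof.
move=> e0 e1 e2; apply/ffunP => i; case: i => -[|[|[|//]]] lt.
- have -> : Ordinal lt = 0%R by apply: val_inj.
  by [].
- have -> : Ordinal lt = 1%R by apply: val_inj.
  by [].
- have -> : Ordinal lt = (-1)%R by apply: val_inj.
  by [].
Qed.

(** Index 2 appears as [-1], and [t.2 i] joins [t.1 i] to [t.1 (i + 1)]. *)
Lemma triangles_onP (U : finType) (S : {set {set U}}) (t : cycle3 U) :
  t \in triangles_on S ->
  [/\ [/\ t.1 0%R != t.1 1%R, t.1 0%R != t.1 (-1)%R & t.1 1%R != t.1 (-1)%R],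
   forall i, t.2 i \in S &
   [/\ t.1 0%R \in t.2 0%R :&: t.2 (-1)%R, t.1 1%R \in t.2 0%R :&: t.2 1%R
     & t.1 (-1)%R \in t.2 1%R :&: t.2 (-1)%R]].
Proof.
rewrite inE => /and4P[/injectiveP inj1 _ /forallP tS /forallP inc].
split=> //; first by rewrite !(inj_eq inj1).
have e1 : (1 - 1 = 0 :> 'I_3)%R by apply: val_inj.
have e2 : (-1 - 1 = 1 :> 'I_3)%R by apply: val_inj.
have e0 : (0 - 1 = -1 :> 'I_3)%R by apply: val_inj.
move: (inc 0%R) (inc 1%R) (inc (-1)%R); rewrite e0 e1 e2.
by move=> /andP[i02 i00] /andP[i10 i11] /andP[i21 i22]; rewrite !inE i02 i00 i10 i11 i21.
Qed.

Lemma card_flags (U : finType) r (S : {set {set U}}) :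
  (forall e, e \in S -> #|e| = r) ->
  #|[set x : {set U} * U | (x.1 \in S) && (x.2 \in x.1)]| = #|S| * r.
Proof.
move=> unif; rewrite -sum_nat_const -sum1_card.
rewrite (partition_big fst (mem S)) /= => [|x]; last by rewrite inE => /andP[].
apply: eq_bigr => e Se; rewrite sum1dep_card -(unif e Se).
rewrite -[RHS](card_imset _ (can_inj (fun x : U => erefl (e, x).2))).
apply: eq_card => -[e' x]; rewrite !inE /=; apply/idP/imsetP => [|[y ye [-> ->]]].
  by move=> /andP[/andP[_ xe] /eqP ee]; exists x; rewrite -?ee.
by rewrite Se ye eqxx.
Qed.

(* Each vertex v lies on at most r ^ 2 * a * min(m * a, d ^ 2) triangles with
   v = v_0, where d is the degree of v and a bounds codegrees: choose e_1 and
   then e_0, e_2, or choose e_0, e_2 and then e_1. Since m * a <= k ^ 2, the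
   minimum is at most k * d, and the degrees sum to at most r * m. *)
Lemma card_triangles_on (U : finType) r k m (V : {set U}) (S : {set {set U}}) :
  S \subset uniform_sets r V -> #|S| <= m -> m * #|V| ^ (r - 2) <= k ^ 2 ->
  #|triangles_on S| <= r ^ 3 * (k * (m * #|V| ^ (r - 2))).
Proof.
move=> /subsetP SV Sm mk; set a := #|V| ^ (r - 2) in mk *.
have unif e : e \in S -> #|e| = r by move/SV; rewrite inE => /andP[_ /eqP].
pose C x y := [set e in S | [set x; y] \subset e].
have C_le x y : x != y -> #|C x y| <= a.
  move=> xy; rewrite /a -(_ : #|[set x; y]| = 2); last by rewrite cards2 xy.
  apply: leq_trans (card_uniform_supersets V [set x; y] r).
  apply/subset_leq_card/subsetP => e; rewrite !inE => /andP[/SV + ->].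
  by rewrite inE => /andP[-> ->].
pose N v := [set t in triangles_on S | t.1 0%R == v].
pose d v := #|[set e in S | v \in e]|.
have inC x y e : e \in S -> x \in e -> y \in e -> e \in C x y.
  by move=> Se xe ye; rewrite inE Se subUset !sub1set xe.
(* The factor [r * r] pays for marking v_1 and v_2 in e_1; then e_0 and e_2 have at most [a] choices
   each. *)
have N1 v : #|N v| <= m * r * r * (a * a).
  pose Fl := [set x : {set U} * U | (x.1 \in S) && (x.2 \in x.1)].
  pose Y := [set y : {set U} * U * U | (y.1 \in Fl) && (y.2 \in y.1.1)].
  have cardY : #|Y| <= m * r * r.
    apply: leq_trans (_ : #|Fl| * r <= _); last first.
      by rewrite (card_flags unif) !leq_mul.
    apply: (card_fiber_le (f := fst)) => [y|x]; first by rewrite inE => /andP[].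
    rewrite inE => /andP[Sx _]; rewrite -(unif _ Sx).
    rewrite -(card_in_imset (f := snd)) => [|[y1 y2] [z1 z2]]; last first.
      by rewrite !inE /= => /andP[_ /eqP ->] /andP[_ /eqP ->] ->.
    apply/subset_leq_card/subsetP => _ /imsetP[[y1 y2] + ->].
    by rewrite !inE /= => /andP[/andP[_ +] /eqP <-].
  apply: leq_trans (leq_mul cardY (leqnn _)).
  pose f (t : cycle3 U) := (t.2 1%R, t.1 1%R, t.1 (-1)%R).
  apply: (card_fiber_le (f := f)) => [t|[[e x] y] _].
    rewrite [t \in _]in_set => /andP[/triangles_onP[_ tS [_ + +]] _].
    by rewrite !inE /= tS => /andP[_ ->] /andP[-> _].
  set X := [set t in N v | _].
  have Xe t : t \in X ->
      [/\ t \in triangles_on S, t.1 0%R = v & [/\ t.2 1%R = e, t.1 1%R = x & t.1 (-1)%R = y]].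
    by rewrite [t \in X]in_set [t \in N v]in_set => /andP[/andP[-> /eqP->]] /eqP[-> -> ->].
  have [->|[t Xt]] := set_0Vmem X; first by rewrite cards0.
  (* A member of the fiber supplies the distinctness of [v] from [x] and [y] that the codegree bound
     asks for. *)
  have [/triangles_onP[[vx vy _] _ _] tv [_ tx ty]] := Xe t Xt.
  rewrite tv tx in vx; rewrite tv ty in vy.
  apply: leq_trans (leq_mul (C_le _ _ vx) (C_le _ _ vy)); rewrite -cardsX.
  rewrite -(card_in_imset (f := fun t : cycle3 U => (t.2 0%R, t.2 (-1)%R))).
    apply/subset_leq_card/subsetP => _ /imsetP[t' Xt' ->].
    have [/triangles_onP[_ tS +] tv' [_ t1 t2]] := Xe t' Xt'.
    rewrite tv' t1 t2 !in_setI => -[/andP[? ?] /andP[? ?] /andP[? ?]].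
    by rewrite in_setX !inC.
  move=> [p1 e1] [p2 e2] /Xe[_ /= a1 [b1 c1 d1]] /Xe[_ /= a2 [b2 c2 d2]] [g1 g2].
  by congr pair; apply: ffun3_eq; congruence.
have N2 v : #|N v| <= d v * r * (d v * r) * a.
  pose Sv := [set e in S | v \in e].
  pose Fl := [set x : {set U} * U | (x.1 \in Sv) && (x.2 \in x.1)].
  have cardFl : #|Fl| = d v * r.
    by apply: card_flags => e; rewrite inE => /andP[/unif].
  rewrite -cardFl -cardsX.
  pose f (t : cycle3 U) := ((t.2 0%R, t.1 1%R), (t.2 (-1)%R, t.1 (-1)%R)).
  apply: (card_fiber_le (f := f)) => [t|[[e x] [e' y]] _].
    rewrite [t \in _]in_set => /andP[/triangles_onP[_ tS +]] /eqP tv.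
    rewrite tv !in_setI => -[/andP[? ?] /andP[? ?] /andP[? ?]].
    by rewrite in_setX !inE /= !tS; apply/andP; split; apply/andP; split.
  set X := [set t in N v | _].
  have Xe t : t \in X ->
      [/\ t \in triangles_on S, t.1 0%R = v
       & [/\ t.2 0%R = e, t.1 1%R = x, t.2 (-1)%R = e' & t.1 (-1)%R = y]].
    by rewrite [t \in X]in_set [t \in N v]in_set => /andP[/andP[-> /eqP->]] /eqP[-> -> -> ->].
  have [->|[t Xt]] := set_0Vmem X; first by rewrite cards0.
  have [/triangles_onP[[_ _ xy] _ _] _ [_ tx _ ty]] := Xe t Xt; rewrite tx ty in xy.
  apply: leq_trans (C_le _ _ xy).
  rewrite -(card_in_imset (f := fun t : cycle3 U => t.2 1%R)).
    apply/subset_leq_card/subsetP => _ /imsetP[t' Xt' ->].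
    have [/triangles_onP[_ tS +] tv [_ t1 _ t2]] := Xe t' Xt'.
    by rewrite t1 t2 !in_setI => -[_ /andP[? ?] /andP[? ?]]; rewrite inC.
  move=> [p1 e1] [p2 e2] /Xe[_ /= a1 [b1 c1 d1 f1]] /Xe[_ /= a2 [b2 c2 d2 f2]] g1.
  by congr pair; apply: ffun3_eq; congruence.
have N_le v : #|N v| <= r ^ 2 * a * k * d v.
  have [lekd|/ltnW ledk] := leqP k (d v).
    apply: leq_trans (N1 v) _; apply: (@leq_trans (r ^ 2 * a * k ^ 2)).
      rewrite (_ : _ * (a * a) = r ^ 2 * a * (m * a)); last by rewrite -mulnn; lia.
      by rewrite leq_mul.
    by rewrite -[leqRHS]mulnA leq_mul // -mulnn leq_mul.
  apply: leq_trans (N2 v) _.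
  rewrite (_ : _ * a = r ^ 2 * a * (d v * d v)); last by rewrite -mulnn; lia.
  by rewrite -[leqRHS]mulnA !leq_mul.
have -> : #|triangles_on S| = \sum_v #|N v|.
  rewrite -sum1_card (partition_big (fun t : cycle3 U => t.1 0%R) predT) //=.
  by apply: eq_bigr => v _; rewrite sum1dep_card.
apply: leq_trans (leq_sum _ (fun v _ => N_le v)) _.
rewrite -big_distrr /= (sum_degree unif).
rewrite (_ : _ * (_ * r) = r ^ 3 * (k * (#|S| * a))); last by rewrite !expnS; lia.
by rewrite !leq_mul.
Qed.

(** * Number of potential patterns *)

Lemma exists_injection (T U : finType) (V : {set U}) :
  #|T| <= #|V| -> exists2 g : T -> U, injective g & forall x, g x \in V.
Proof.
move=> leTV; exists (fun x => enum_val (widen_ord leTV (enum_rank x))) => [x y|x].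
  by move=> /enum_val_inj/(congr1 val)/= /val_inj/enum_rank_inj.
exact: enum_valP.
Qed.

(** Rounding [n / b] down loses less than a factor 2, because the quotient is positive. *)
Lemma exp_leq_div n b e X : 0 < b -> b <= n -> (n %/ b) ^ e <= X ->
  n ^ e <= (2 * b) ^ e * X.
Proof.
move=> b_gt0 leb leX; apply: leq_trans (leq_mul (leqnn _) leX).
rewrite -expnMn; have [->|e_gt0] := posnP e; first by [].
have := divn_gt0 n b_gt0; rewrite leb => d_gt0.
by rewrite leq_exp2r //; have := divn_eq n b; have := ltn_pmod n b_gt0; nia.
Qed.

(** Take [r.+1] disjoint blocks of [b] vertices in [V]; picking one vertex per block gives
    [b ^ r.+1] distinct simplices. *)
Lemma card_potential_simplices (U : finType) (V : {set U}) r : r.+1 <= #|V| ->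
  #|V| ^ r.+1 <= (2 * r.+1) ^ r.+1 * #|[set s : {set U} | (s \subset V) && (#|s| == r.+1)]|.
Proof.
move=> leV; apply: exp_leq_div => //; set b := _ %/ _.
have [|g g_inj gV] := @exists_injection ('I_r.+1 * 'I_b)%type U V.
  by rewrite card_prod !card_ord mulnC leq_divM.
rewrite -[X in b ^ X]card_ord -[X in X ^ _]card_ord -card_ffun.
pose s (f : {ffun 'I_r.+1 -> 'I_b}) := [set g (i, f i) | i : 'I_r.+1].
have s_inj : injective s.
  move=> f f' eqs; apply/ffunP => i.
  have : g (i, f i) \in s f' by rewrite -eqs imset_f.
  by case/imsetP => i' _ /g_inj[<-].
rewrite -(card_imset predT s_inj); apply/subset_leq_card/subsetP => _ /imsetP[f _ ->].
rewrite inE card_imset ?card_ord ?eqxx ?andbT; last by move=> i i' /g_inj[].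
by apply/subsetP => _ /imsetP[i _ ->].
Qed.

Lemma ord3_neq (i j : 'I_3) : i != j -> j = (i + 1)%R \/ i = (j + 1)%R.
Proof.
by case: i j => -[|[|[|//]]] ? [[|[|[|//]]] ?] // _;
  (left; apply: val_inj; reflexivity) || (right; apply: val_inj; reflexivity).
Qed.

(* The members of an edge of the triangle are drawn one from each of the blocks
   (i, 0), ..., (i, r - 2), and the vertex in block (i + 1, 0) completes it. *)
Lemma card_potential_triangles (U : finType) (V : {set U}) r : 2 <= r ->
  3 * (r - 1) <= #|V| ->
  #|V| ^ (3 * (r - 1)) <= (2 * (3 * (r - 1))) ^ (3 * (r - 1)) *
    #|[set t in triangles_on (uniform_sets r V) | is_induced t]|.
Proof.
case: r => [|[|r]] // _; rewrite subn1 /= => leV.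
apply: exp_leq_div => //; set b := _ %/ _.
have [|g g_inj gV] := @exists_injection ('I_3 * 'I_r.+1 * 'I_b)%type U V.
  by rewrite !card_prod !card_ord mulnC leq_divM.
pose F : finType := {ffun 'I_3 * 'I_r.+1 -> 'I_b}.
have cardF : #|F| = b ^ (3 * r.+1) by rewrite card_ffun card_prod !card_ord.
pose pt (f : F) i j := g (i, j, f (i, j)).
pose ed (f : F) i := pt f (i + 1)%R ord0 |: [set pt f i j | j : 'I_r.+1].
pose tri (f : F) : cycle3 U := ([ffun i => pt f i ord0], [ffun i => ed f i]).
have pt_inj f f' i j i' j' : pt f i j = pt f' i' j' -> i = i' /\ j = j' /\ f (i, j) = f' (i, j).
  by move=> /g_inj[-> -> ->].
have pt_ed f i : pt f i ord0 \in ed f i by rewrite !inE imset_f ?orbT.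
have in_ed f f' i j i' : pt f i j \in ed f' i' -> i = i' \/ i = (i' + 1)%R.
  rewrite !inE => /orP[/eqP/pt_inj[-> _]|/imsetP[j' _ /pt_inj[-> _]]]; by [right | left].
have succ_neq (i : 'I_3) : (i + 1)%R != i by case: i => -[|[|[|]]].
have succ2_neq (i : 'I_3) : (i + 1 + 1)%R != i by case: i => -[|[|[|]]].
(* This is inducedness. It also separates the three edges, since two different indices modulo 3 are
   consecutive. *)
have not_ed f i : pt f i ord0 \notin ed f (i + 1)%R.
  by apply/negP => /in_ed[] /esym/eqP; rewrite ?(negPf (succ_neq i)) ?(negPf (succ2_neq i)).
(* The value [f (i, j)] is read off from edge [i], which has exactly one vertex in block
   [(i, j)]. *)
have tri_inj : injective tri.
  move=> f f' [_ /ffunP eqe]; apply/ffunP => -[i j].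
  have : pt f i j \in ed f' i.
    by have := eqe i; rewrite !ffunE => <-; rewrite !inE imset_f ?orbT.
  rewrite !inE => /orP[/eqP/pt_inj[/esym/eqP]|/imsetP[j' _ /pt_inj[_ [_ ->//]]]].
  by rewrite (negPf (succ_neq i)).
rewrite -cardF -(card_imset predT tri_inj).
apply/subset_leq_card/subsetP => _ /imsetP[f _ ->].
rewrite !inE /=; apply/andP; split; last by apply/forallP => i; rewrite !ffunE.
apply/and4P; split.
- by apply/injectiveP => i i'; rewrite !ffunE => /pt_inj[].
- apply/injectiveP => i i'; rewrite !ffunE => eqe; apply/eqP/negP => /negP/ord3_neq[] ii'.
    by have := not_ed f i; rewrite -ii' -eqe pt_ed.
  by have := not_ed f i'; rewrite -ii' eqe pt_ed.
- apply/forallP => i; rewrite ffunE inE; apply/andP; split.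
    by apply/subsetP => x; rewrite !inE => /orP[/eqP->|/imsetP[j _ ->]]; apply: gV.
  rewrite cardsU1 card_imset => [|j j' /pt_inj[_ []]//]; rewrite card_ord.
  case: imsetP => // -[j _ /pt_inj[/eqP]].
  by rewrite (negPf (succ_neq i)).
- apply/forallP => i; rewrite !ffunE pt_ed andbT.
  by rewrite /ed GRing.subrK !inE eqxx.
Qed.

(** * Compatible inputs and transcripts *)

Lemma card_bigcup_le (I T : finType) (W : {set I}) (F : I -> {set T}) c :
  (forall i, i \in W -> #|F i| <= c) -> #|\bigcup_(i in W) F i| <= #|W| * c.
Proof.
move=> le_c; rewrite -sum_nat_const.
apply: (@leq_trans (\sum_(i in W) #|F i|)); last exact: leq_sum.
by elim/big_rec2: _ => [|i b X _ le_b];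
  rewrite ?cards0 // (leq_trans (leq_card_setU _ _)) // leq_add2l.
Qed.

(** Count pairs of an input and a pattern present in it. Each pattern occurs in at least a fraction
    [2 ^ - q] of the inputs. Inputs outside [G], and inputs on which some output involves more than
    [m] edges, each make up at most a fraction [2 ^ - q.+2]; every other input has at most [n * X]
    patterns. *)
Lemma card_patterns_le (E T V Z : finType) (n q N m X : nat) (W : {set V})
    (Pat : {set T}) (supp : T -> {set E}) (view : V -> {set E} -> Z)
    (out : V -> Z -> {set T}) (G : {set {set E}}) :
  #|W| <= n -> (forall p, p \in Pat -> #|supp p| <= q) ->
  (forall v, v \in W -> #|[set view v F | F : {set E}]| <= 2 ^ N) ->
  (forall F, F \in G -> \bigcup_(v in W) out v (view v F)
                        = [set p in Pat | supp p \subset F]) ->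
  (forall S : {set E}, #|S| <= m -> #|[set p in Pat | supp p \subset S]| <= X) ->
  #|~: G| * 2 ^ q.+2 <= 2 ^ #|E| -> n * 2 ^ (q.+2 + N) <= 2 ^ m ->
  #|Pat| <= 2 ^ q.+1 * (n * X).
Proof.
move=> Wn suppq viewN outG SX Gbig mbig.
set M := #|E|.
pose known v z := \bigcup_(p in out v z) supp p.
pose bad v := [set F in G | m < #|known v (view v F)|].
have known_sub v F : v \in W -> F \in G -> known v (view v F) \subset F.
  move=> Wv GF; apply/bigcupsP => p outp.
  suff : p \in [set p in Pat | supp p \subset F] by rewrite inE => /andP[].
  by rewrite -outG //; apply/bigcupP; exists v.
have bad_le v : v \in W -> #|bad v| * 2 ^ m <= 2 ^ (N + M).
  (* If [M <= m], no set of potential edges has more than [m] elements; otherwise [M - m] is a true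
     difference. *)
  move=> Wv; have [leMm | ltmM] := leqP M m.
    suff -> : bad v = set0 by rewrite cards0.
    apply/setP=> F; rewrite !inE; apply/andP => -[GF].
    by rewrite ltnNge (leq_trans _ leMm) // max_card.
  apply: (@leq_trans (2 ^ N * 2 ^ (M - m) * 2 ^ m)); last first.
    by rewrite -mulnA -!expnD subnK // ltnW.
  rewrite leq_mul2r; apply/orP; right.
  apply: leq_trans (_ : _ <= #|[set view v F | F : {set E}]| * 2 ^ (M - m)) _;
    last by rewrite leq_mul2r viewN ?orbT.
  apply: (card_fiber_le (f := view v)) => [F _|z _]; first exact: imset_f.
  have [ltz|lez] := ltnP m #|known v z|; last first.
    rewrite (_ : [set _ in _ | _] = set0) ?cards0 //.
    apply/setP => F; rewrite !inE; apply/andP => -[/andP[_ +] /eqP zE].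
    by rewrite zE ltnNge lez.
  apply: (@leq_trans #|[set F : {set E} | known v z \subset F]|).
    apply/subset_leq_card/subsetP => F; rewrite !inE.
    by move=> /andP[/andP[GF _] /eqP <-]; apply: known_sub.
  by rewrite card_supersets leq_exp2l // leq_sub2l // ltnW.
pose Bad := \bigcup_(v in W) bad v.
have Bad_le : #|Bad| * 2 ^ q.+2 <= 2 ^ M.
  rewrite -(@leq_pmul2r (2 ^ m)) ?expn_gt0 //.
  have : #|Bad| * 2 ^ m <= n * 2 ^ (N + M).
    apply: leq_trans (_ : (\sum_(v in W) #|bad v|) * 2 ^ m <= _).
      rewrite leq_mul2r; apply/orP; right; rewrite /Bad.
      by elim/big_rec2: _ => [|v b Y _ le_b];
        rewrite ?cards0 // (leq_trans (leq_card_setU _ _)) // leq_add2l.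
    rewrite big_distrl /=; apply: leq_trans (leq_sum _ bad_le) _.
    by rewrite sum_nat_const leq_mul2r Wn orbT.
  rewrite -(@leq_pmul2r (2 ^ q.+2)) ?expn_gt0 // mulnAC => /leq_trans; apply.
  by rewrite -mulnA -expnD (_ : N + M + q.+2 = q.+2 + N + M);
    [rewrite expnD mulnA mulnC leq_mul2l mbig orbT | lia].
pose H := G :\: Bad.
have H_le : #|~: H| * 2 ^ q.+1 <= 2 ^ M.
  have : #|~: H| <= #|~: G| + #|Bad|.
    by rewrite /H setDE setCI setCK; apply: leq_card_setU.
  rewrite -(@leq_pmul2r (2 ^ q.+2)) ?expn_gt0 // => le_sum.
  rewrite -(@leq_pmul2l 2) //; apply: leq_trans (_ : _ <= 2 ^ M + 2 ^ M) _.
    apply: leq_trans (leq_trans le_sum _); first by rewrite mulnCA -expnS.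
    by rewrite mulnDl leq_add.
  by rewrite addnn -mul2n.
have small F : F \in H -> #|[set p in Pat | supp p \subset F]| <= n * X.
  rewrite inE => /andP[nbad GF]; rewrite -outG //.
  apply: leq_trans (_ : #|W| * X <= _); last by rewrite leq_mul2r Wn orbT.
  apply: card_bigcup_le => v Wv.
  apply: leq_trans (SX (known v (view v F)) _); last first.
    rewrite leqNgt; apply: contra nbad => big.
    by apply/bigcupP; exists v; rewrite // inE GF.
  apply/subset_leq_card/subsetP => p outp; rewrite inE bigcup_sup // andbT.
  suff : p \in [set p in Pat | supp p \subset F] by rewrite inE => /andP[].
  by rewrite -outG //; apply/bigcupP; exists v.
have lower : #|Pat| * 2 ^ M
    <= (\sum_(F in [set: {set E}]) #|[set p in Pat | supp p \subset F]|) * 2 ^ q.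
  rewrite (double_count _ _ (fun (F : {set E}) p => supp p \subset F)).
  rewrite -sum_nat_const big_distrl /=; apply: leq_sum => p Pp.
  apply: leq_trans (_ : 2 ^ (M - #|supp p|) * 2 ^ q <= _).
    by rewrite -expnD leq_exp2l //; have := suppq p Pp; lia.
  rewrite leq_mul2r -card_supersets; apply/orP; right.
  by apply/subset_leq_card/subsetP => F; rewrite !inE.
have upper : \sum_(F in [set: {set E}]) #|[set p in Pat | supp p \subset F]|
    <= 2 ^ M * (n * X) + #|~: H| * #|Pat|.
  rewrite (big_setID H) /= setTI setTD leq_add //.
    apply: leq_trans (leq_sum _ small) _.
    rewrite sum_nat_const leq_mul2r; apply/orP; right.
    by rewrite -[M]cardsT -card_powerset powersetT subset_leq_card // subsetT.
  rewrite -sum_nat_const; apply: leq_sum => F _.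
  by apply/subset_leq_card/subsetP => p; rewrite inE => /andP[].
(* The excluded inputs account for at most half of the pairs guaranteed by [lower], so the other
   half is bounded through [n * X]. *)
have : #|Pat| * 2 ^ M * 2 <= (2 ^ q.+1 * (n * X)) * 2 ^ M + #|Pat| * 2 ^ M.
  apply: leq_trans (_ : (2 ^ M * (n * X) + #|~: H| * #|Pat|) * 2 ^ q.+1 <= _).
    rewrite expnSr mulnA leq_mul2r /=; apply: leq_trans lower _.
    by rewrite leq_mul2r upper orbT.
  rewrite mulnDl; apply: leq_add; first by rewrite mulnC (mulnC (2 ^ M)) mulnA.
  by rewrite mulnAC mulnC leq_mul2l H_le orbT.
by rewrite muln2 -addnn leq_add2r leq_pmul2r ?expn_gt0.
Qed.

(** * Input hypergraphs and finite encodings of local views *)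

Fact uniform_sub_valid (U : finType) r (V : {set U}) (F : {set {set U}}) :
  0 < r -> forall e, e \in F :&: uniform_sets r V -> e != set0 /\ e \subset V.
Proof.
move=> r_gt0 e; rewrite !inE => /and3P[_ -> /eqP er].
by rewrite -card_gt0 er.
Qed.

(** [F] ranges over all families of subsets of [U], and members outside [uniform_sets r V] are
    ignored. A uniformly random [F] thus makes each potential edge present independently with
    probability 1/2. *)
Definition uniform_sub (U : finType) r (r_gt0 : 0 < r) (V : {set U})
    (F : {set {set U}}) : hypergraph U :=
  Hypergraph (uniform_sub_valid (V := V) (F := F) r_gt0).

Lemma uniform_subP (U : finType) r (r_gt0 : 0 < r) (V : {set U}) F :
  uniform r (uniform_sub r_gt0 V F).
Proof. by move=> e; rewrite !inE => /and3P[_ _ /eqP]. Qed.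

Definition silent (U : finType) B : inbox U B := [ffun=> None].

Section Transcript.
Variables (M : model) (U : finType) (B : nat) (H : hypergraph U).
Variables (p : protocol M U B) (coins : U -> nat -> bool).

Definition history t v := view_received (run H p coins t v).

Lemma size_history t v : size (history t v) = t.
Proof. by rewrite /history; elim: t => //= t IH; rewrite size_rcons IH. Qed.

Lemma runE t v : run H p coins t v = View v (incident H v) (coins v) (history t v).
Proof. by rewrite /history; case: t. Qed.

Lemma history_silent t v i e u :
  ~~ [&& e \in edges H, u \in e & v \in e] ->
  nth (silent U B) (history t v) i (e, u) = None.
Proof.
move=> /negPf out; rewrite /history; elim: t => [|t IH] /=.
  by rewrite nth_default // ffunE.
rewrite nth_rcons; case: ltngtP => _ //; first by rewrite ffunE.
by rewrite ffunE /= out.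
Qed.

(* Together with the identifier and the coins, this determines the view
   (see transcriptK), and unlike a view it ranges over a finite type. *)
Definition transcript t v :
    {set {set U}} * {ffun 'I_t * ({set U} * U) -> option (message B)} :=
  (incident H v, [ffun x : 'I_t * ({set U} * U) => nth (silent U B) (history t v) x.1 x.2]).

Definition replay t (z : {set {set U}} * {ffun 'I_t * ({set U} * U) -> option (message B)}) :
    seq (inbox U B) := [seq [ffun y => z.2 (i, y)] | i <- enum 'I_t].

Lemma transcriptK t v : replay (transcript t v) = history t v.
Proof.
apply: (@eq_from_nth _ (silent U B)).
  by rewrite size_map size_enum_ord size_history.
move=> i; rewrite size_map size_enum_ord => lt_it.
rewrite (nth_map (Ordinal lt_it)) ?size_enum_ord //.
by apply/ffunP => y; rewrite !ffunE /= nth_enum_ord.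
Qed.

End Transcript.

Lemma card_support_sub (aT rT : finType) (y : rT) (D : {set aT}) :
  #|[set g : {ffun aT -> rT} | y.-support g \subset D]| = #|rT| ^ #|D|.
Proof.
rewrite -(card_pffun_on y (mem D) predT); apply: eq_card => g; rewrite inE.
by apply/idP/pffun_onP => [gD|[]//]; split=> // _ _; rewrite inE.
Qed.

(** At most [n ^ (r - 1)] potential edges contain [v]. Each costs one bit for its presence and, in
    each round, one slot per member with [2 ^ B + 1 <= 2 ^ B.+1] values. All other slots stay
    [None]. *)
Lemma card_transcripts (M : model) (U : finType) (B r t : nat) (r_gt0 : 0 < r)
    (V : {set U}) (p : protocol M U B) (coins : U -> nat -> bool) v :
  #|[set transcript (uniform_sub r_gt0 V F) p coins t v | F : {set {set U}}]|
  <= 2 ^ (#|V| ^ (r - 1) * (1 + r * B.+1 * t)).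
Proof.
set n := #|V|.
pose Inc := [set e in uniform_sets r V | v \in e].
have IncE F : incident (uniform_sub r_gt0 V F) v \subset Inc.
  by apply/subsetP => e; rewrite !inE => /andP[/andP[_ ->] ->].
have Inc_le : #|Inc| <= n ^ (r - 1).
  rewrite -(cards1 v); apply: leq_trans (card_uniform_supersets V [set v] r).
  by apply/subset_leq_card/subsetP => e; rewrite !inE sub1set -andbA.
pose Sl := [set x : 'I_t * ({set U} * U) | (x.2.1 \in Inc) && (x.2.2 \in x.2.1)].
have Sl_le : #|Sl| <= t * (n ^ (r - 1) * r).
  have -> : Sl = setX setT [set y : {set U} * U | (y.1 \in Inc) && (y.2 \in y.1)].
    by apply/setP => -[i y]; rewrite in_setX !inE.
  rewrite cardsX cardsT card_ord (@card_flags _ r) ?leq_mul //.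
  by move=> e; rewrite !inE => /andP[/andP[_ /eqP]].
pose Z := setX (powerset Inc)
  [set g : {ffun 'I_t * ({set U} * U) -> option (message B)} | None.-support g \subset Sl].
apply: (@leq_trans #|Z|).
  apply/subset_leq_card/subsetP => _ /imsetP[F _ ->].
  rewrite in_setX powersetE IncE inE /=.
  apply/supportP => -[i [e u]] notSl; rewrite ffunE history_silent //=.
  apply: contra notSl => /and3P[+ ue ve].
  by rewrite !inE /= => /and3P[_ -> ->]; rewrite ue ve.
rewrite cardsX card_powerset card_support_sub card_option card_tuple card_bool.
apply: leq_trans (_ : 2 ^ #|Inc| * (2 ^ B.+1) ^ #|Sl| <= _).
  rewrite leq_mul2l; apply/orP; right.
  case: #|Sl| => // s; rewrite leq_exp2r //.
  by rewrite expnS mul2n -addnn -addn1 leq_add2l expn_gt0.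
by rewrite -expnM -expnD leq_exp2l //; nia.
Qed.

(** * Simplices and triangles as patterns with a support *)

Lemma simplices_patterns (U : finType) (V : {set U}) r (r_gt0 : 0 < r) F :
  simplices r (uniform_sub r_gt0 V F) =
  [set s in [set s : {set U} | (s \subset V) && (#|s| == r.+1)]
     | [set f : {set U} | (f \subset s) && (#|f| == r)] \subset F].
Proof.
apply/setP => s; rewrite !inE -andbA; case: (boolP (s \subset V)) => //= sV.
congr andb; apply/forallP/subsetP => [sF f|sF f].
  by rewrite inE => fs; have /implyP/(_ fs) := sF f; rewrite !inE => /andP[].
apply/implyP => fs; have /andP[fs1 fr] := fs.
by rewrite !inE sF ?inE // (subset_trans fs1 sV).
Qed.

Definition triangle_edges (U : finType) (t : cycle3 U) := [set t.2 i | i : 'I_3].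

Lemma triangle_edges_sub (U : finType) (S : {set {set U}}) (t : cycle3 U) :
  (triangle_edges t \subset S) = [forall i, t.2 i \in S].
Proof.
apply/subsetP/forallP => [tS i|tS _ /imsetP[i _ ->]//].
by apply: tS; apply: imset_f.
Qed.

Lemma triangles_onI (U : finType) (S S' : {set {set U}}) :
  triangles_on (S :&: S') = [set t in triangles_on S' | triangle_edges t \subset S].
Proof.
apply/setP => t; rewrite !inE triangle_edges_sub.
have -> : [forall i, t.2 i \in S :&: S'] =
    [forall i, t.2 i \in S'] && [forall i, t.2 i \in S].
  apply/forallP/andP => [tS|[/forallP tS' /forallP tS] i]; last by rewrite inE tS tS'.
  by split; apply/forallP => i; have := tS i; rewrite inE => /andP[].
by case: (injectiveb _); case: (injectiveb _) => //=; rewrite andbAC.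
Qed.

Lemma trianglesE (U : finType) (H : hypergraph U) :
  triangles H = triangles_on (edges H).
Proof. by []. Qed.

End Combinatorics.

(** * Lower bounds on the number of rounds *)

Local Open Scope ring_scope.

(** The expected number of events that occur is at least [prob * #|I|]. The count is an integer at
    most [#|I|], so some [w] maximizes it, and the maximum is at least the mean. *)
Lemma exists_average (R : realType) (d : measure_display)
    (Omega : measurableType d) (P : probability Omega R) (I : finType)
    (A : I -> set Omega) (prob : R) :
  (forall i, measurable (A i) /\ (prob%:E <= P (A i))%E) ->
  exists w, prob * #|I|%:R <= #|[set i | `[< A i w >]]%SET|%:R.
Proof.
move=> hA; pose S w := #|[set i | `[< A i w >]]%SET|.
have SE w : (S w)%:R = \sum_(i : I) \1_(A i) w :> R.
  rewrite /S -sum1dep_card natr_sum big_mkcond; apply: eq_bigr => i _.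
  by rewrite indicE; case: asboolP => [Aw|nAw]; [rewrite mem_set | rewrite memNset].
have exS : exists j, `[< exists w, S w = j >] by exists (S point); apply/asboolP; exists point.
have [j /asboolP[w <-] maxw] := ex_maxnP exS (fun j Pj =>
  let: ex_intro w Sj := asboolW Pj in eq_ind _ (fun j => (j <= #|I|)%N) (max_card _) _ Sj).
exists w; rewrite -lee_fin.
have {}maxw w' : (S w' <= S w)%N by apply: maxw; apply/asboolP; exists w'.
have <- : (\int[P]_(x in [set: Omega]%classic) (S w)%:R%:E = (S w)%:R%:E)%E.
  by rewrite integral_cst // [X in (_ * X)%E]probability_setT mule1.
apply: (@le_trans _ _ (\int[P]_(x in [set: Omega]%classic) \sum_(i : I) (\1_(A i) x)%:E)%E).
  rewrite ge0_integral_sum //; last first.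
    by move=> i; apply/measurable_EFinP; apply: measurable_indic; have [] := hA i.
  apply: (@le_trans _ _ (\sum_(i : I) prob%:E)%E).
    by rewrite sumEFin sumr_const cardT -cardE mulr_natr.
  apply: lee_sum => i _; rewrite integral_indic // ?classical_sets.setIT; by have [] := hA i.
apply: ge0_le_integral => //.
- by move=> x _; apply: sume_ge0 => i _; rewrite lee_fin.
- apply: emeasurable_sum => i.
  by apply/measurable_EFinP; apply: measurable_indic; have [] := hA i.
- by move=> x _; rewrite sumEFin lee_fin -SE ler_nat.
Qed.

Lemma solves_card_patterns (R : realType) (q r n B : nat) (r_ge2 : (2 <= r)%N)
    (M : model) (U T : finType) (A : algorithm M U B T)
    (target : hypergraph U -> {set T}) (V : {set U}) (Pat : {set T})
    (supp : T -> {set {set U}}) (X : nat) (d : measure_display)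
    (Omega : measurableType d) (P : probability Omega R)
    (bit : U * nat -> Omega -> bool) :
  #|V| = n ->
  (forall F, target (uniform_sub (ltnW r_ge2) V F)
             = [set p in Pat | supp p \subset F]%SET) ->
  (forall p, p \in Pat -> (#|supp p| <= q)%N) ->
  (forall S : {set {set U}},
     (#|S| <= n ^ (r - 1) * (q + 4 + r * B.+1 * rounds A))%N ->
     (#|[set p in Pat | supp p \subset S]%SET| <= X)%N) ->
  solves (1 - 2^-1 ^+ q.+2 : R)%R r n A target P bit ->
  (#|Pat| <= 2 ^ q.+1 * (n * X))%N.
Proof.
move=> Vn targetE suppq SX solvesA.
pose H F := uniform_sub (ltnW r_ge2) V F.
pose success F w := correct A target (H F) (fun v k => bit (v, k) w).
have [w good] := exists_average (A := success)
  (fun F => solvesA (H F) (@uniform_subP U r (ltnW r_ge2) V F) Vn).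
set G := [set F | _]%SET in good.
pose t := rounds A.
pose coins v k := bit (v, k) w.
pose view v F := transcript (H F) (comm A) coins t v.
(* With the coins fixed, the view is rebuilt from the transcript, so the output depends on finite
   data only. *)
pose out v z := output A (View v z.1 (coins v) (replay (t := t) z)).
apply: (@card_patterns_le {set U} T U _ n q (n ^ (r - 1) * (1 + r * B.+1 * t))
          (n ^ (r - 1) * (q + 4 + r * B.+1 * t)) X V Pat supp view out G) => //.
- by rewrite Vn.
- by move=> v _; rewrite -Vn; apply: card_transcripts.
- move=> F; rewrite inE => /asboolP[_ targetF]; rewrite -targetE -targetF.
  by apply: eq_bigr => v _; rewrite /out transcriptK runE.
- have cardE : #|{: {set {set U}}}| = (2 ^ #|{set U}|)%N.
    by rewrite -cardsT -powersetT card_powerset cardsT.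
  rewrite -cardE -(@ler_nat R) natrM natrX.
  move: good; rewrite -{1}(cardsC G) natrD => good.
  move/(congr1 (fun m => m%:R : R)): (cardsC G); rewrite natrD => NE.
  have gt0 : (0 : R) < 2 ^+ q.+2 by rewrite exprn_gt0.
  rewrite -ler_pdivlMr // mulrC -exprVn; rewrite -NE; lra.
- have [->|n_gt0] := posnP n; first by rewrite mul0n.
  apply: (@leq_trans (2 ^ n * 2 ^ (q.+2 + n ^ (r - 1) * (1 + r * B.+1 * t)))%N).
    by rewrite leq_mul2r ltnW ?orbT // ltn_expl.
  rewrite -expnD leq_exp2l //.
  have : (n <= n ^ (r - 1))%N.
    by rewrite -{1}(expn1 n) leq_pexp2l // subn_gt0.
  nia.
Qed.

Lemma exists_subset_card (U : finType) n :
  (n <= #|U|)%N -> exists V : {set U}, #|V| = n.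
Proof.
rewrite -bin_gt0 -card_draws card_gt0 => /set0Pn[V].
by rewrite inE => /eqP; exists V.
Qed.

(* With x = n ^ (1 / p.+1) and k of order delta * x ^ j, the identity relating
   p, b and j says that n ^ b * s is of order k ^ p when s is of order x, and
   then n * k * (n ^ b * s) is of order delta ^ p.+1 * n ^ j.+1. *)
Lemma exists_balanced_exponent (R : realType) (x delta : R) (p b j n s C D : nat) :
  (0 < p)%N -> 0 < delta -> delta <= 1 -> 1 <= delta * x ->
  x ^+ p.+1 = n%:R -> (0 < j)%N -> (p.+1 * b + 1 = p * j)%N ->
  s%:R <= delta ^+ p * x -> D%:R * (2 * C%:R) * delta < 1 ->
  exists k, (n ^ b * s <= k ^ p)%N /\
    (D * (n * (C * (k * (n ^ b * s)))) < n ^ j.+1)%N.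
Proof.
move=> p_gt0 d_gt0 d_le1 dx_ge1 xn j_gt0 pbj s_le small.
have x_ge1 : 1 <= x.
  by rewrite (le_trans dx_ge1) // ler_piMl // -(pmulr_rge0 _ d_gt0) (le_trans _ dx_ge1).
have x_gt0 : 0 < x by apply: lt_le_trans x_ge1.
pose y := delta * x ^+ j.
have y_ge1 : 1 <= y.
  by rewrite (le_trans dx_ge1) // ler_wpM2l ?(ltW d_gt0) // ler_eXnr.
have K_le : (n ^ b * s)%:R <= y ^+ p.
  rewrite natrM natrX -xn -exprM exprMn -exprM (mulnC j) -pbj exprD expr1.
  by rewrite mulrCA ler_wpM2l // exprn_ge0 // ltW.
(* Rounding up at most doubles [y], as [1 <= y]; this is the 2 in the smallness hypothesis. *)
exists (Num.truncn y).+1; set k := _.+1.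
have y_le : y <= k%:R by rewrite ltW // truncnS_gt.
have k_le : k%:R <= 2 * y.
  have /andP[+ _] : (Num.truncn y)%:R <= y < k%:R by apply: truncn_itv; lra.
  by rewrite /k -natr1; lra.
split.
  rewrite -(ler_nat R) (le_trans K_le) // natrX.
  by rewrite lerXn2r // nnegrE ?ler0n //; lra.
rewrite -(ltr_nat R).
apply: (@le_lt_trans _ _ (D%:R * (n%:R * (C%:R * (2 * y * y ^+ p))))).
  rewrite natrM ler_wpM2l // natrM ler_wpM2l // natrM ler_wpM2l // natrM.
  by rewrite ler_pM.
have -> : D%:R * (n%:R * (C%:R * (2 * y * y ^+ p)))
    = (D%:R * (2 * C%:R) * delta) * delta ^+ p * n%:R ^+ j.+1.
  have -> : y ^+ p = delta ^+ p * (x ^+ p) ^+ j by rewrite exprMn exprAC.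
  rewrite exprS -xn [in RHS](exprS x) exprMn /y [x ^+ p.+1 in LHS]exprS; ring.
rewrite natrX -[ltRHS]mul1r ltr_pM2r; last by rewrite -xn !exprn_gt0.
apply: le_lt_trans small; rewrite ler_piMr //; last by rewrite exprn_ile1 // ltW.
by rewrite !mulr_ge0 // ltW.
Qed.

(** With too few rounds, the upper bound on [#|Pat|] from [solves_card_patterns] falls below the
    lower bound of order [n ^ j.+1]. The exponent [a] carries the codegree factor of the pattern
    count, and the identity on exponents makes the two bounds balance at [n ^ (1 / p.+1)]. *)
Lemma requires_rounds_of_patterns (R : realType) (r : nat) (hr : (2 <= r)%N)
    (T : finType -> finType) (target : forall U : finType, hypergraph U -> {set T U})
    (p a j q C c0 n0 : nat) :
  (0 < p)%N -> (0 < j)%N -> (p.+1 * (r - 1 + a) + 1 = p * j)%N ->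
  (forall (U : finType) (V : {set U}),
     exists (Pat : {set T U}) (supp : T U -> {set {set U}}),
     [/\ forall F, target U (uniform_sub (ltnW hr) V F)
                   = [set x in Pat | supp x \subset F]%SET,
         forall x, x \in Pat -> (#|supp x| <= q)%N,
         forall (S : {set {set U}}) k m, (#|S| <= m)%N -> (m * #|V| ^ a <= k ^ p)%N ->
           (#|[set x in Pat | supp x \subset S]%SET| <= C * (k * (m * #|V| ^ a)))%N
       & (n0 <= #|V|)%N -> (#|V| ^ j.+1 <= c0 * #|Pat|)%N]) ->
  requires_rounds r target (fun n => n%:R `^ (p.+1%:R)^-1 / ln n%:R : R).
Proof.
move=> p_gt0 j_gt0 pbj patterns.
have h_gt0 : (0 : R) < 2^-1 ^+ q.+2 by rewrite exprn_gt0.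
have h_lt1 : (2^-1 ^+ q.+2 : R) < 1 by rewrite exprn_ilt1 //; lra.
exists (1 - 2^-1 ^+ q.+2 : R); first by apply/andP; split; lra.
move=> L B _ leL; rewrite bigThetaE => -[/eqO_exP[K K_gt0 leB] _].
pose D := (c0 * 2 ^ q.+1)%N.
pose delta : R := (D%:R * (2 * C%:R) + 1)^-1.
have den_ge1 : 1 <= D%:R * (2 * C%:R) + 1 :> R.
  by rewrite lerDr mulr_ge0 // mulr_ge0.
have d_gt0 : 0 < delta by rewrite invr_gt0; lra.
have d_le1 : delta <= 1 by rewrite invf_le1 //; lra.
have small : D%:R * (2 * C%:R) * delta < 1.
  by rewrite ltr_pdivrMr ?mul1r //; lra.
(* [W] exceeds twice [r * (K + 1)], so the part of [s] that grows with the rounds stays below half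
   of [delta ^+ p * x]. *)
pose W : R := 2 * (r%:R * (K + 1)) + 1.
have W_gt0 : 0 < W.
  by rewrite ltr_wpDl // mulr_ge0 // mulr_ge0 // addr_ge0 // ltW.
exists (delta ^+ p / W); first by rewrite divr_gt0 // exprn_gt0.
(* Once [x] reaches [Y], the constant [q + 4] takes at most the other half of [delta ^+ p * x], and
   [1 <= delta * x]. *)
pose Y : R := (2 * (q + 4)%:R) / delta ^+ p + delta^-1.
have Y_ge0 : 0 <= Y.
  by rewrite addr_ge0 // ?divr_ge0 ?exprn_ge0 ?invr_ge0 ?mulr_ge0 // ltW.
near=> n => M A d Omega P bit _ solvesA.
pose U : finType := (L n).-tuple bool.
have n_ge : Y ^+ p.+1 <= n%:R by near: n; apply: nbhs_infty_ger.
(* From e on the logarithm is at least 1, which absorbs the successor in [(B n).+1]. *)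
have n_ge3 : expR 1 <= n%:R :> R by near: n; apply: nbhs_infty_ger.
have n_ge0 : (n0 <= n)%N by near: n; apply: nbhs_infty_ge.
have nL : (n <= 2 ^ L n)%N by near: n.
have Bn : `|(B n)%:R : R| <= K * `|ln n%:R| by near: n.
have ln_ge1 : 1 <= ln n%:R :> R.
  by rewrite -[leLHS](expRK 1) ler_ln // posrE ?expR_gt0 // (lt_le_trans (expR_gt0 1)).
have {}Bn : (B n).+1%:R <= (K + 1) * ln n%:R :> R.
  by move: Bn; rewrite normr_nat ger0_norm; [rewrite -natr1; lra | lra].
set x : R := n%:R `^ (p.+1%:R)^-1.
have x_ge0 : 0 <= x by apply: powR_ge0.
have xn : x ^+ p.+1 = n%:R.
  by rewrite -powR_mulrn // -powRrM mulVf ?pnatr_eq0 // powRr1.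
have x_ge : Y <= x by rewrite -(ler_pXn2r (ltn0Sn p)) ?nnegrE // xn.
rewrite leNgt; apply/negP => few.
have [V Vn] := @exists_subset_card U n ltac:(by rewrite card_tuple card_bool).
have [Pat [supp [targetE suppq count lower]]] := patterns U V.
pose s := (q + 4 + r * (B n).+1 * rounds A)%N.
have dx_ge1 : 1 <= delta * x.
  rewrite -ler_pdivrMl // mulr1; apply: le_trans x_ge; rewrite lerDr.
  by rewrite divr_ge0 // ?exprn_ge0 // ltW.
have s_le : s%:R <= delta ^+ p * x.
  have half1 : (q + 4)%:R <= delta ^+ p * x / 2.
    have : 2 * (q + 4)%:R / delta ^+ p <= x.
      by apply: le_trans x_ge; rewrite lerDl invr_ge0 ltW.
    by rewrite ler_pdivrMr ?exprn_gt0 //; lra.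
  have half2 : (r * (B n).+1 * rounds A)%:R <= delta ^+ p * x / 2.
    have l_gt0 : 0 < ln n%:R :> R by lra.
    have dx_ge0 : 0 <= delta ^+ p * x by rewrite mulr_ge0 // exprn_ge0 // ltW.
    apply: (@le_trans _ _ (r%:R * ((K + 1) * ln n%:R) * (delta ^+ p / W * (x / ln n%:R)))).
      by rewrite !natrM ler_pM ?mulr_ge0 // ?ler_wpM2l // ltW.
    have -> : r%:R * ((K + 1) * ln n%:R) * (delta ^+ p / W * (x / ln n%:R))
        = delta ^+ p * x * (r%:R * (K + 1) / W).
      by field; rewrite !gt_eqF.
    by rewrite ler_wpM2l // ler_pdivrMr // /W; lra.
  by rewrite /s natrD; lra.
have [k [k_ge contra]] := exists_balanced_exponent p_gt0 d_gt0 d_le1 dx_ge1 xn j_gt0 pbj s_le small.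
move: contra; apply/negP; rewrite -leqNgt.
have shuffle : (n ^ (r - 1) * s * #|V| ^ a = n ^ (r - 1 + a) * s)%N.
  by rewrite Vn expnD mulnAC.
have PatX : (#|Pat| <= 2 ^ q.+1 * (n * (C * (k * (n ^ (r - 1 + a) * s)))))%N.
  apply: (solves_card_patterns Vn targetE suppq _ solvesA) => S leS.
  by rewrite -shuffle; apply: count; rewrite // shuffle.
rewrite -{1}Vn (leq_trans (lower _)) ?Vn //.
by rewrite /D -mulnA leq_mul2l PatX orbT.
Unshelve. all: by end_near.
Qed.

(** * Application to triangles and simplices *)

(** Treats all triangles and induced triangles at once: the upper count holds for any subfamily of
    the triangles, the lower count for any family containing the induced ones. *)
Lemma triangle_family_requires_rounds (R : realType) (r : nat) (hr : (2 <= r)%N)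
    (target : forall U : finType, hypergraph U -> {set cycle3 U})
    (Q : forall U : finType, pred (cycle3 U)) :
  (forall U (H : hypergraph U), target U H = [set t in triangles H | Q U t]%SET) ->
  (forall U, {subset @is_induced U <= Q U}) ->
  requires_rounds r (T := fun U => cycle3 U) target
    (fun n => n%:R `^ 3%:R^-1 / ln n%:R : R).
Proof.
move=> targetE indQ.
apply: (@requires_rounds_of_patterns R r hr (fun U => cycle3 U) target 2 (r - 2)
  (3 * (r - 1)).-1 3 (r ^ 3) ((2 * (3 * (r - 1))) ^ (3 * (r - 1))) (3 * (r - 1)));
  [by [] | lia | lia |].
move=> U V; exists [set t in triangles_on (uniform_sets r V) | Q U t]%SET.
have patE (S : {set {set U}}) : [set t in [set t in triangles_on (uniform_sets r V) | Q U t]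
    | triangle_edges t \subset S]%SET
    = [set t in triangles_on (S :&: uniform_sets r V) | Q U t]%SET.
  by apply/setP => t; rewrite triangles_onI !in_set andbAC.
exists (@triangle_edges U); split.
- by move=> F; rewrite targetE trianglesE patE.
- by move=> t _; rewrite (leq_trans (leq_imset_card _ _)) // card_ord.
- move=> S k m Sm mk; rewrite patE.
  apply: leq_trans (card_triangles_on (S := S :&: uniform_sets r V) _ _ mk).
  + by apply/subset_leq_card/subsetP => t; rewrite in_set => /andP[].
  + exact: subsetIr.
  + by apply: leq_trans Sm; apply/subset_leq_card/subsetIl.
- move=> leV; rewrite prednK; last by lia.
  apply: leq_trans (card_potential_triangles hr leV) _.
  rewrite leq_mul2l; apply/orP; right; apply/subset_leq_card/subsetP => t.
  by rewrite !in_set => /andP[-> /indQ].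
Qed.

Theorem corollary14 (R : realType) (r : nat) (hr : (2 <= r)%N) :
  [/\ requires_rounds r (T := fun U => {set U}) (fun U => @simplices r U)
        (fun n => n%:R `^ (r.+1%:R)^-1 / ln n%:R : R),
      requires_rounds r (T := fun U => cycle3 U) (fun U => @triangles U)
        (fun n => n%:R `^ 3%:R^-1 / ln n%:R : R)
    & requires_rounds r (T := fun U => cycle3 U) (fun U => @induced_triangles U)
        (fun n => n%:R `^ 3%:R^-1 / ln n%:R : R)].
Proof.
split.
- apply: (@requires_rounds_of_patterns R r hr (fun U => {set U}) (fun U => @simplices r U)
    r 0 r r.+1 1 ((2 * r.+1) ^ r.+1) r.+1); [lia | lia | lia |].
  move=> U V; exists [set s : {set U} | (s \subset V) && (#|s| == r.+1)]%SET.
  exists (fun s : {set U} => [set f : {set U} | (f \subset s) && (#|f| == r)]%SET); split.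
  + exact: simplices_patterns.
  + by move=> s; rewrite inE => /andP[_ /eqP cs]; rewrite cards_draws cs binSn.
  + move=> S k m Sm; rewrite expn0 muln1 mul1n => mk.
    (* Only members of size [r] can be facets, and [card_full_simplices] asks for a uniform
       family. *)
    set S' := S :&: [set e : {set U} | #|e| == r]%SET.
    have S'm : (#|S'| <= m)%N by apply: leq_trans Sm; apply/subset_leq_card/subsetIl.
    apply: leq_trans (leq_mul (leqnn k) S'm).
    apply: leq_trans (card_full_simplices (r := r) _ _ (leq_trans S'm mk)); last 2 first.
    * exact: ltnW.
    * by move=> e; rewrite !inE => /andP[_ /eqP].
    apply/subset_leq_card/subsetP => s; rewrite !inE => /andP[/andP[_ ->] /subsetP sS] /=.
    apply/forallP => f; apply/implyP => fs; have /andP[_ fr] := fs.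
    by rewrite !inE fr andbT sS // inE.
  + exact: card_potential_simplices.
- apply: (triangle_family_requires_rounds R hr (Q := fun U => xpredT)) => [U H|U t] //.
  by apply/setP => t; rewrite !inE andbT.
- apply: (triangle_family_requires_rounds R hr (Q := @is_induced)) => [U H|U t] //.
  by apply/setP => t; rewrite !inE.
Qed.
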